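(* Let $t$ be a term that can be evaluated in interval arithmetic, in which no variable occurs more than once, and let $x_1,\ldots,x_n$ be the variables of $t$. Let $S$ be the interval constraint satisfaction problem (ICSP) obtained by translating $t$, where $x_1,\ldots,x_n$ have as domains the intervals $X_1,\ldots,X_n$ and where the internal variables have domain $[-\infty,+\infty]$. Then applying PSI (Propagation with Selective Initialization) to $S$ terminates after selecting no constraint more than once. Moreover, on termination the root variable (the variable labeling the root of the tree of $t$) has domain $Z$, where $Z$ is the interval resulting from evaluating $t$ in interval arithmetic with $x_1,\ldots,x_n$ substituted by $X_1,\ldots,X_n$.
   Context: **Intervals.** Let $F$ be a fixed finite set of reals. A floating-point number is an element of $F\cup\{-\infty,+\infty\}$. An interval is a closed connected set of reals whose bounds, in so far as they exist, are floating-point numbers; $[-\infty,+\infty]$ denotes the whole real line, and similarly for half-lines. A box is a Cartesian product of intervals. $\varphi(A)$ denotes the smallest interval containing a set $A$ of reals. **Constraints, DROs, ICSPs.** A constraint is an atomic formula $c(x_1,\ldots,x_n)$ without function symbols; its predicate symbol denotes a relation $r$ on the reals. Each variable $x_i$ has a domain $X_i$. A value $a_i$ for $x_i$ is inconsistent with respect to $r$ and the domains $X_j$ ($j\neq i$) iff there are no $a_j\in X_j$ ($j\ne i$) with $\langle a_1,\ldots,a_n\rangle\in r$. A domain reduction operator (DRO) for $c$ may replace domains of the variables of $c$ by subsets, removing only inconsistent values; every DRO is contracting, monotonic and idempotent. It is optimal if every domain is replaced by the smallest domain containing all its consistent values. A constraint is primitive if an (efficiently computable) optimal DRO is available for it;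 this is the DRO associated with the constraint. An ICSP is a finite set of primitive constraints together with an interval as domain for each variable. **Default domains and seed constraints.** The default domain of an argument of a constraint is the domain of that argument after applying the DRO of the constraint when all its variables have domain $[-\infty,+\infty]$ (e.g. for $sin(x,y)$, meaning $y=\sin x$, the default domain of $y$ is $[-1,1]$). A constraint of an ICSP is a seed constraint iff at least one of its variables has a domain that differs from the default domain of that variable as an argument of that constraint. **Tree form and translation.** A term is a variable or a function symbol with terms as arguments. It is viewed as a tree whose leaves are variables and whose internal nodes are function symbols; every internal node is labeled with a unique new variable (an internal variable). Constants are replaced by unique variables whose domains contain the constants and are as small as possible. The translation of a term to an ICSP has exactly one constraint for each internal node: a node $f(t_0,\ldots,t_{n-1})$ labeled by $y$, whose child nodes are labeled by (or are) the variables $x_0,\ldots,x_{n-1}$, yields the constraint $F(x_0,\ldots,x_{n-1},y)$, where $F(a_0,\ldots,a_{n-1},v)$ holds iff $v=f(a_0,\ldots,a_{n-1})$. **Interval arithmetic evaluation.** Every function symbol denotes a function $f$ that is defined on reals as well as on intervals (the interval extension of $f$), the interval result being $\varphi(\{f(a_0,\ldots,a_{n-1}) : a_j\in A_j\})$ for interval arguments $A_0,\ldots,A_{n-1}$. The evaluation of a term is recursive: a variable evaluates to the interval substituted for it; $f(t_0,\ldots,t_{n-1})$ evaluates to the interval extension of $f$ applied to the evaluations of the $t_j$. **PSI.** The active set $A$ is a set of constraints organized as a priority queue: the greater the distance from the root of the tree to the node that generated a constraint, the earlier the constraint is removed from the queue. Initially $A$ contains all seed constraints and no other ones. While $A\neq\emptyset$: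 select a constraint $C$ from $A$ (according to priority); apply the DRO associated with $C$; if one of the domains has become empty, stop; add to $A$ all constraints involving variables whose domains have changed, if any; remove $C$ from $A$. *)

(* Defs.v *)
From HB Require Import structures.
From mathcomp Require Import all_boot all_order all_algebra.
From mathcomp Require Import all_classical all_reals all_analysis.

Set Implicit Arguments.
Unset Strict Implicit.
Unset Printing Implicit Defensive.

Import Order.TTheory GRing.Theory Num.Theory.
Import numFieldNormedType.Exports.

Local Open Scope classical_set_scope.
Local Open Scope ring_scope.

Section Intervals.
Context {R : realType}.
Implicit Types (F A : set R).

(* [F] is the set of finite floating-point numbers.  The empty set is an
   interval in this sense: domains may become empty. *)
Definition fp_interval F A : Prop :=
  [/\ closed A, connected A, has_sup A -> F (sup A) & has_inf A -> F (inf A)].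

Definition hull F A : set R := smallest (fp_interval F) A.

Lemma fp_interval_hull F A : finite_set F -> fp_interval F (hull F A).
Proof.
move=> finF; set H := hull F A.
have HM M : fp_interval F M -> A `<=` M -> H `<=` M.
  exact: smallest_sub.
have inH x : (forall M, fp_interval F M -> A `<=` M -> M x) -> H x.
  by move=> h M /= [FM AM]; exact: h.
have gap s : ~ F s -> exists2 e, 0 < e & forall r, F r -> e <= `|s - r|.
  move=> Fs.
  have : closed F.
    by apply (@accessible_finite_set_closed R) => //;
      apply: hausdorff_accessible; exact: norm_hausdorff.
  rewrite -openC openE => /(_ s Fs) /nbhs_ballP[e /= e0 eF].
  by exists e => // r Fr; rewrite leNgt; apply/negP => /eF /(_ Fr).
split.
- by apply: closed_bigI => M [[]].
- apply/connected_intervalP => x y Hx Hy z xzy; apply: inH => M FM AM.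
  have [_ /connected_intervalP cM _ _] := FM.
  by apply: (cM x y) => //; exact: (HM M FM AM).
- move=> hsH; apply: contrapT => /gap[e e0 eF].
  suff : H (sup H + e / 2).
    by move=> /(sup_upper_bound hsH); rewrite gerDl leNgt divr_gt0.
  apply: inH => M FM AM; have HsM := HM M FM AM.
  have [_ /connected_intervalP cM supM _] := FM.
  have [x Hx] := hsH.1.
  have xs : x <= sup H by exact: sup_upper_bound.
  have [y My sy] : exists2 y, M y & sup H + e / 2 <= y.
    apply: contrapT => noy.
    have uM : ubound M (sup H + e / 2).
      move=> y My; rewrite leNgt; apply/negP => /ltW ys.
      by apply: noy; exists y.
    have hsM : has_sup M by split; [exists x; exact: HsM|exists (sup H + e / 2)].
    have := eF _ (supM hsM); rewrite distrC ger0_norm; last first.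
      rewrite subr_ge0; apply: ge_sup; first by exists x.
      by move=> y Hy; apply: sup_upper_bound => //; exact: HsM.
    rewrite lerBrDr => es.
    have : sup M <= sup H + e / 2 by apply: ge_sup => //; exact: hsM.1.
    move/(le_trans es); rewrite addrC lerD2l leNgt.
    by rewrite ltr_pdivrMr // mulr_natr mulr2n ltrDl e0.
  apply: (cM x y) => //; first exact: HsM.
  by rewrite sy andbT (le_trans xs) // lerDl ltW // divr_gt0.
- move=> hiH; apply: contrapT => /gap[e e0 eF].
  suff : H (inf H - e / 2).
    by move=> /(ge_inf hiH.2); rewrite lerBrDr gerDl leNgt divr_gt0.
  apply: inH => M FM AM; have HsM := HM M FM AM.
  have [_ /connected_intervalP cM _ infM] := FM.
  have [x Hx] := hiH.1.
  have xs : inf H <= x by apply: ge_inf => //; exact: hiH.2.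
  have [y My sy] : exists2 y, M y & y <= inf H - e / 2.
    apply: contrapT => noy.
    have uM : lbound M (inf H - e / 2).
      move=> y My; rewrite leNgt; apply/negP => /ltW ys.
      by apply: noy; exists y.
    have hiM : has_inf M by split; [exists x; exact: HsM|exists (inf H - e / 2)].
    have := eF _ (infM hiM); rewrite ger0_norm; last first.
      rewrite subr_ge0; apply: lb_le_inf; first by exists x.
      by move=> y Hy; apply: ge_inf; [exact: hiM.2|exact: HsM].
    rewrite lerBrDr => es.
    have : inf H - e / 2 <= inf M by apply: lb_le_inf => //; exact: hiM.1.
    rewrite lerBlDr => si; move: (le_trans es si); rewrite addrC lerD2l leNgt.
    by rewrite ltr_pdivrMr // mulr_natr mulr2n ltrDl e0.
  apply: (cM y x) => //; first exact: HsM.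
  by rewrite sy /= (le_trans _ xs) // gerBl ltW // divr_gt0.
Qed.

End Intervals.

Section Constraints.
Context {R : realType} {W : Type}.

Record constraint := Constraint {
  con_arity : nat;
  con_var : 'I_con_arity -> W;
  con_rel : set ('I_con_arity -> R) }.

Arguments con_var : clear implicits.
Arguments con_rel : clear implicits.

HB.instance Definition _ := gen_eqMixin constraint.

(* The domain of each variable. *)
Definition domains := W -> set R.

Implicit Types (F : set R) (c : constraint) (D : domains) (w : W).

Definition involves c w : Prop := exists j, con_var c j = w.

(* Tuples of arguments are given by valuations of the variables, so that
   several occurrences of a variable in a constraint receive the same value. *)
Definition consistent c D w (v : R) : Prop :=
  exists s : W -> R, [/\ s w = v, con_rel c (s \o con_var c) &
    forall w', involves c w' -> w' <> w -> D w' (s w')].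

Definition interval_domains F c D : Prop :=
  forall w, involves c w -> fp_interval F (D w).

Definition dro_fun := domains -> domains.

Record is_dro F c (g : dro_fun) : Prop := IsDro {
  dro_interval : forall D, interval_domains F c D ->
    interval_domains F c (g D);
  dro_other : forall D, interval_domains F c D ->
    forall w, ~ involves c w -> g D w = D w;
  dro_sound : forall D, interval_domains F c D ->
    forall w v, D w v -> ~ g D w v -> ~ consistent c D w v;
  dro_contracting : forall D, interval_domains F c D ->
    forall w, g D w `<=` D w;
  dro_monotonic : forall D D', interval_domains F c D ->
    interval_domains F c D' -> (forall w, D w `<=` D' w) ->
    forall w, g D w `<=` g D' w;
  dro_idempotent : forall D, interval_domains F c D -> g (g D) = g D }.

Definition optimal F c (g : dro_fun) : Prop :=
  forall D, interval_domains F c D -> forall w, involves c w ->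
    g D w = hull F (D w `&` [set v | consistent c D w v]).

Definition optimal_dro F c (g : dro_fun) : Prop := is_dro F c g /\ optimal F c g.

Lemma optimal_dro_exists F c : finite_set F -> exists g, optimal_dro F c g.
Proof.
move=> finF.
pose sol D w := D w `&` [set v | consistent c D w v].
pose g D w := if `[< involves c w >] then hull F (sol D w) else D w.
have gE D w : involves c w -> g D w = hull F (sol D w).
  by move=> cw; rewrite /g asboolT.
have gN D w : ~ involves c w -> g D w = D w.
  by move=> cw; rewrite /g asboolF.
have g_itv D : interval_domains F c (g D).
  by move=> w cw; rewrite gE//; exact: fp_interval_hull.
have g_sub D : interval_domains F c D -> forall w, g D w `<=` D w.
  move=> DF w; have [cw|cw] := pselect (involves c w); last by rewrite gN.
  by rewrite gE//; apply: smallest_sub; [exact: DF|move=> v []].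
have sol_sub D w : involves c w -> sol D w `<=` g D w.
  by move=> cw; rewrite gE//; exact: sub_gen_smallest.
have sol_mono D D' w : (forall w', involves c w' -> D w' `<=` D' w') ->
    involves c w -> sol D w `<=` sol D' w.
  move=> DD' cw v [Dv [s [sv cs Ds]]]; split; first exact: DD'.
  exists s; split => // w' cw' ww'; apply: DD' => //; exact: Ds.
have solg D w : involves c w -> sol D w `<=` sol (g D) w.
  move=> cw v sv; split; first exact: sol_sub.
  have [Dv [s [sw cs Ds]]] := sv.
  exists s; split => // w' cw' w'w; apply: sol_sub => //; split.
    exact: Ds.
  exists s; split => // w2 cw2 w2w'.
  by have [->|/Ds] := pselect (w2 = w); [rewrite sw|exact].
exists g; split; last by move=> D _ w; exact: gE.
split => // [D _ w|D _ w v Dv gv cv|D D' _ _ DD' w|D DF].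
- exact: gN.
- have [cw|cw] := pselect (involves c w); last by apply: gv; rewrite gN.
  by apply: gv; apply: sol_sub.
- have [cw|cw] := pselect (involves c w); last by rewrite !gN.
  rewrite !gE//; apply: smallest_sub; first exact: fp_interval_hull.
  apply: (@subset_trans _ (sol D' w)); last exact: sub_gen_smallest.
  exact: sol_mono.
- apply/funext => w; apply/seteqP; split; first exact: g_sub.
  have [cw|cw] := pselect (involves c w); last by rewrite !gN.
  rewrite {1}gE//; apply: smallest_sub; first exact: g_itv.
  by apply: subset_trans (sol_sub _ _ cw); exact: solg.
Qed.

Record icsp := Icsp {
  icsp_con : set constraint;
  icsp_dom : domains;
  icsp_finite : finite_set icsp_con }.

End Constraints.

Arguments constraint : clear implicits.
Arguments domains : clear implicits.
Arguments dro_fun : clear implicits.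
Arguments icsp : clear implicits.

Section PSI.
Context {R : realType} {W : Type}.
(* [dro c] is the operator associated with [c]; [before c c'] means that [c]
   has a strictly higher priority than [c']. *)
Variables (dro : constraint R W -> dro_fun R W).
Variables (before : constraint R W -> constraint R W -> Prop).
Variable S : icsp R W.

Definition default_domain (c : constraint R W) (w : W) : set R :=
  dro c (fun=> setT) w.

Definition seed : set (constraint R W) :=
  [set c | icsp_con S c /\
     exists2 w, involves c w & icsp_dom S w <> default_domain c w].

(* [Stopped D] is the state reached when a domain has become empty. *)
Inductive config :=
| Running of domains R W & set (constraint R W)
| Stopped of domains R W.

Definition config_dom (k : config) : domains R W :=
  match k with Running D _ => D | Stopped D => D end.

Definition final (k : config) : Prop :=
  match k with Running _ A => A = set0 | Stopped _ => True end.

Definition selectable (A : set (constraint R W)) (c : constraint R W) : Prop :=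
  A c /\ forall c', A c' -> ~ before c' c.

Definition emptied (D D' : domains R W) : Prop :=
  exists2 w, D w !=set0 & D' w = set0.

Definition affected (D D' : domains R W) : set (constraint R W) :=
  [set c | icsp_con S c /\ exists2 w, involves c w & D' w <> D w].

Inductive psi_step : config -> constraint R W -> config -> Prop :=
| StepStop D A c : selectable A c -> emptied D (dro c D) ->
    psi_step (Running D A) c (Stopped (dro c D))
| StepNext D A c : selectable A c -> ~ emptied D (dro c D) ->
    psi_step (Running D A) c
      (Running (dro c D) ((A `|` affected D (dro c D)) `\ c)).

Definition psi_init : config := Running (icsp_dom S) seed.

(* [psi_run k s k']: [k'] can be reached from [k] by selecting successively
   the constraints of [s]. *)
Inductive psi_run : config -> seq (constraint R W) -> config -> Prop :=
| RunNil k : psi_run k [::] k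
| RunCons k c k1 s k' : psi_step k c k1 -> psi_run k1 s k' ->
    psi_run k (c :: s) k'.

(* Whatever the choices among constraints of equal priority, execution from
   [k] reaches a final configuration after finitely many steps. *)
Inductive psi_terminates : config -> Prop :=
| TermFinal k : final k -> psi_terminates k
| TermStep k : (exists c k', psi_step k c k') ->
    (forall c k', psi_step k c k' -> psi_terminates k') -> psi_terminates k.

End PSI.

(* Function symbols denote partial functions on the reals ([None] where
   undefined); a total function is the special case in which [None] is never
   returned.  Symbols of arity 0 are the constants. *)
Record signature (R : realType) := Signature {
  symbol : Type;
  arity : symbol -> nat;
  denote : forall f : symbol, ('I_(arity f) -> R) -> option R }.

Arguments symbol {R} s.
Arguments arity {R s} f.
Arguments denote {R s} f a.

Inductive term (R : realType) (Sg : signature R) (V : Type) :=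
| Var (x : V)
| App (f : symbol Sg) (args : 'I_(arity f) -> term Sg V).

Arguments Var {R Sg V} x.
Arguments App {R Sg V} f args.

Section Terms.
Context {R : realType} {Sg : signature R} {V : Type}.
Variable F : set R.
Implicit Types (t : term Sg V) (p : seq nat) (X : V -> set R).

(* The node of the tree reached from the root along the child indices [p]. *)
Fixpoint subterm t p : option (term Sg V) :=
  match p, t with
  | [::], _ => Some t
  | _ :: _, Var _ => None
  | i :: p', App f args =>
      if insub i is Some j then subterm (args j) p' else None
  end.

Definition occurs_at t (x : V) p : Prop := subterm t p = Some (Var x).

Definition occurs t (x : V) : Prop := exists p, occurs_at t x p.

Definition no_repeated_var t : Prop :=
  forall x p q, occurs_at t x p -> occurs_at t x q -> p = q.

Definition interval_ext (f : symbol Sg) (B : 'I_(arity f) -> set R) : set R :=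
  hull F [set v | exists2 a, (forall j, B j (a j)) & denote f a = Some v].

Fixpoint ieval X t : set R :=
  match t with
  | Var x => X x
  | App f args => interval_ext (fun j => ieval X (args j))
  end.

(* [t] can be evaluated: at every node the function is defined on the whole
   box of the arguments. *)
Fixpoint evaluable X t : Prop :=
  match t with
  | Var _ => True
  | App f args => (forall j, evaluable X (args j)) /\
      forall a, (forall j, ieval X (args j) (a j)) -> denote f a <> None
  end.

(* [inl x] is the variable [x] of the term; [inr p] is the new variable
   labeling the function symbol at position [p]. *)
Definition icsp_var : Type := V + seq nat.

Definition label t p : icsp_var :=
  match t with Var x => inl x | App _ _ => inr p end.

Definition root_var t : icsp_var := label t [::].

(* F(x_0, ..., x_(n-1), y), where y is the last argument. *)
Definition symbol_constraint (f : symbol Sg) (x : 'I_(arity f) -> icsp_var)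
    (y : icsp_var) : constraint R icsp_var :=
  @Constraint R icsp_var (arity f).+1
    (fun k => if unlift ord_max k is Some j then x j else y)
    [set a | denote f (fun j => a (lift ord_max j)) = Some (a ord_max)].

(* Constants are leaves and generate no constraint. *)
Definition node_constraint t p : option (constraint R icsp_var) :=
  match subterm t p with
  | Some (App f args) =>
      if arity f == 0%N then None
      else Some (symbol_constraint (fun j => label (args j) (rcons p j)) (inr p))
  | _ => None
  end.

Definition term_constraints t : set (constraint R icsp_var) :=
  [set c | exists p, node_constraint t p = Some c].

Definition initial_domain X t (w : icsp_var) : set R :=
  match w with
  | inl x => X x
  | inr p =>
      match subterm t p with
      | Some (App f args) =>
          if arity f == 0%N then hull F [set v | exists a, denote f a = Some v]
          else setT
      | _ => setT
      end
  end.

Lemma finite_positions t : finite_set [set p | subterm t p <> None].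
Proof.
elim: t => [x|f args IH].
  by apply: (sub_finite_set _ (finite_set1 [::])) => -[|i p] //=.
have fin : finite_set ([set [::]] `|` \bigcup_(j in [set: 'I_(arity f)])
    (cons (j : nat) @` [set p | subterm (args j) p <> None])).
  rewrite finite_setU; split; first exact: finite_set1.
  apply: bigcup_finite; first exact: finite_finset.
  by move=> j _; apply: finite_image; exact: IH.
apply: (sub_finite_set _ fin) => -[|i p] /=; first by left.
case: insubP => [j _ ji|//] jp; right; exists j => //=.
by exists p => //; rewrite ji.
Qed.

Lemma finite_term_constraints t : finite_set (term_constraints t).
Proof.
have fin := finite_image (node_constraint t) (finite_positions t).
have -> : term_constraints t = Some @^-1` (node_constraint t @`
    [set p | subterm t p <> None]).
  apply/seteqP; split => c /=; last by move=> [p _ pc]; exists p.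
  move=> [p pc]; exists p => // pN.
  by move: pc; rewrite /node_constraint pN.
by apply: finite_preimage fin => x y _ _ [].
Qed.

Definition translate X t : icsp R icsp_var :=
  Icsp (initial_domain X t) (finite_term_constraints t).

(* Constraints generated by nodes farther from the root come first. *)
Definition deeper t (c c' : constraint R icsp_var) : Prop :=
  exists p p', [/\ node_constraint t p = Some c,
    node_constraint t p' = Some c' & (size p' < size p)%N].

End Terms.

Arguments icsp_var : clear implicits.

(* Main.v *)
Require Import Defs.
From mathcomp Require Import all_boot all_order all_algebra.
From mathcomp Require Import all_classical all_reals all_analysis.

(** Selecting the constraint of a node, once all its descendants are done, is
one step of interval arithmetic.  The child variables then carry the intervals
of the subterms; since the function is defined on that whole box, no value of a
child is inconsistent, and the operator only replaces the domain of the node by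
the hull of the image of the box ([dro_symbol_output], [dro_symbol_other]).
This uses that the variables of a node constraint are distinct, which is where
the hypothesis on repeated variables enters ([label_inj]).

Hence a selection changes at most the variable of the selected node, and wakes
up at most the constraint of its parent, which is strictly nearer to the root.
As the deepest active constraint is always selected, depths never increase
along a run, so nothing can be reactivated after its selection; runs are thus
repetition-free and, there being finitely many constraints, finite.  This part
is independent of terms ([psi_invariant]).

The value at the root comes from the invariant [coherent]: an inactive node
carries the interval image of the current domains of its children.  It holds
initially even though only seed constraints are active, because a constraint
all of whose domains are default domains is left unchanged by its idempotent
operator ([dro_default]).  When no constraint is active, the invariant read
from the leaves to the root is the recursive definition of interval evaluation
([coherent_below]). *)

Set Implicit Arguments.
Unset Strict Implicit.
Unset Printing Implicit Defensive.

Import Order.TTheory GRing.Theory Num.Theory.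
Import numFieldNormedType.Exports.

Local Open Scope classical_set_scope.

(** * Hulls *)

Section Hull.
Context {R : realType}.
Implicit Types (F A : set R).

Lemma sub_hull F A : A `<=` hull F A.
Proof. exact: sub_gen_smallest. Qed.

Lemma hull_id F A : fp_interval F A -> hull F A = A.
Proof. exact: smallest_id. Qed.

Lemma fp_intervalT F : fp_interval F setT.
Proof.
split.
- exact: closedT.
- by apply/connected_intervalP.
- move=> [_ [u uT]]; have := uT (u + 1)%R I.
  by rewrite gerDl ler10.
- by move=> [_]; rewrite /has_lbound lboundT => -[].
Qed.

End Hull.

(** * Propagation by decreasing priority *)

Section PriorityPropagation.
Context {R : realType} {W : Type}.
Variables (dro : constraint R W -> dro_fun R W).
Variables (before : constraint R W -> constraint R W -> Prop).
Variable S : icsp R W.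
Hypothesis before_irr : forall c, ~ before c c.
Hypothesis before_trans :
  forall c1 c2 c3, before c1 c2 -> before c2 c3 -> before c1 c3.

Lemma exists_selectable A :
  finite_set A -> A !=set0 -> exists c, selectable before A c.
Proof.
move=> /finite_seqP[l lA] A0.
have {lA} : A `<=` [set` l] by rewrite lA.
elim: l A A0 => [|a l IH] A [c Ac] Al; first by have := Al c Ac.
have [[c' Bc']|noB] := pselect (exists c', (A `\ a) c'); last first.
  have Aa c' : A c' -> c' = a.
    by move=> Ac'; apply: contrapT => ca; apply: noB; exists c'.
  by exists c; split => // c' Ac'; rewrite (Aa _ Ac) (Aa _ Ac').
have [||m [[Am ma] mB]] := IH (A `\ a); first by exists c'.
  by move=> d [Ad da]; have := Al d Ad; rewrite /= inE => /orP[/eqP|].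
have [[Aa am]|noa] := pselect (A a /\ before a m).
  exists a; split => // d Ad da; have [dE|dE] := pselect (d = a).
    by apply: (before_irr (c := a)); rewrite dE in da.
  exact: (mB d (conj Ad dE) (before_trans da am)).
exists m; split => // d Ad dm; have [dE|dE] := pselect (d = a).
  by apply: noa; rewrite -dE.
exact: (mB d (conj Ad dE) dm).
Qed.

Variable Inv : domains R W -> set (constraint R W) -> Prop.
Hypothesis Inv_active : forall D A, Inv D A -> A `<=` icsp_con S.
Hypothesis Inv_step : forall D A c, Inv D A -> selectable before A c ->
  [/\ ~ emptied D (dro c D),
      Inv (dro c D) ((A `|` affected S D (dro c D)) `\ c) &
      forall c', affected S D (dro c D) c' -> c' <> c -> before c c'].

(** Absence from [A] alone is not preserved for the constraints [h] selected so
far: an active constraint of strictly higher priority could later reactivate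
one of them, so such constraints are excluded as well. *)
Definition retired (h : seq (constraint R W)) (A : set (constraint R W)) :=
  forall c, c \in h ->
    [/\ icsp_con S c, ~ A c & forall c', A c' -> ~ before c' c].

Lemma psi_step_Inv D A c k : Inv D A ->
  psi_step dro before S (Running D A) c k ->
  selectable before A c /\
  k = Running (dro c D) ((A `|` affected S D (dro c D)) `\ c).
Proof.
move=> inv step; inversion step as [? ? ? sel emp|]; subst; last by [].
by have [] := Inv_step inv sel.
Qed.

(** Newly activated constraints have strictly lower priority than the selected
one, which itself has no higher priority than any constraint of [h]: by
transitivity they are not in [h], and the history grows without repetition. *)
Lemma psi_run_retired k s k' : psi_run dro before S k s k' ->
  forall D A h, k = Running D A -> Inv D A -> retired h A -> uniq h ->
  exists D' A',
    [/\ k' = Running D' A', Inv D' A', retired (h ++ s) A' & uniq (h ++ s)].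
Proof.
elim=> [{}k|{}k c k1 {}s {}k' step _ IH] D A h kE inv ret uh.
  by exists D, A; rewrite cats0.
rewrite kE in step; have [sel k1E] := psi_step_Inv inv step.
have [_ inv' aff] := Inv_step inv sel.
have [Ac minc] := sel.
rewrite -cat_rcons; apply: (IH _ _ _ k1E inv'); last first.
  by rewrite rcons_uniq uh andbT; apply/negP => /ret[].
(* No newly activated constraint precedes a retired one. *)
have up c' c'' : ~ before c c' -> before c'' c' ->
    affected S D (dro c D) c'' -> c'' <> c -> False.
  by move=> ncc' c''c' /aff/[apply] /before_trans /(_ c''c').
move=> c'; rewrite mem_rcons inE => /orP[/eqP ->|/ret[Sc' nAc' ncc']].
  split; first exact: (Inv_active inv).
    by move=> [_] /(_ erefl).
  move=> c'' [[Ac''|aff''] nc'' lt]; first exact: minc lt.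
  by apply: (up c c'') => //.
split=> //.
  (* Reactivating [c'] would mean that [c] precedes [c']. *)
  move=> [[//|aff'] /= nc'c].
  exact: ncc' Ac (aff _ aff' nc'c).
move=> c'' [[/ncc'//|aff''] nc'' lt].
by apply: (up c' c'') => //; exact: ncc'.
Qed.

Lemma exists_psi_step D A : Inv D A -> A !=set0 ->
  exists c k', psi_step dro before S (Running D A) c k'.
Proof.
move=> inv A0.
have [c selc] := exists_selectable
  (sub_finite_set (Inv_active inv) (icsp_finite S)) A0.
have [nemp _ _] := Inv_step inv selc.
by exists c; eexists; exact: StepNext.
Qed.

(** A bound on the lengths of all runs turns into termination, which quantifies
over every choice among constraints of equal priority. *)
Lemma psi_terminates_bounded N D A : Inv D A ->
  (forall s k', psi_run dro before S (Running D A) s k' -> (size s <= N)%N) ->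
  psi_terminates dro before S (Running D A).
Proof.
elim: N D A => [|N IH] D A inv bnd;
  (have [A0|/set0P A0] := eqVneq A set0; first exact: TermFinal).
  have [c [k' step]] := exists_psi_step inv A0.
  by have := bnd _ _ (RunCons step (RunNil _ _ _ _)).
apply: TermStep; first exact: exists_psi_step.
move=> c k' step; have [sel k'E] := psi_step_Inv inv step.
have [_ inv' _] := Inv_step inv sel; rewrite k'E in step *.
by apply: IH => // s k'' run; have := bnd _ _ (RunCons step run).
Qed.

(** The constraints of a run are pairwise distinct members of a finite set,
whose cardinality bounds the length of every run. *)
Lemma psi_invariant D A : Inv D A ->
  [/\ psi_terminates dro before S (Running D A),
      forall s k, psi_run dro before S (Running D A) s k -> uniq s &
      forall s k, psi_run dro before S (Running D A) s k -> final k ->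
        Inv (config_dom k) set0].
Proof.
move=> inv; have run s k (r : psi_run dro before S (Running D A) s k) :=
  @psi_run_retired _ _ _ r D A [::] erefl inv (fun _ => ltac:(by [])) isT.
have /finite_seqP[l lS] := icsp_finite S.
split.
- apply: (@psi_terminates_bounded (size l)) => // s k /run[D' [A' [_ _ ret us]]].
  apply: uniq_leq_size us _ => c /ret[Sc _ _].
  by have : [set` l] c by rewrite -lS.
- by move=> s k /run[D' [A' []]].
- by move=> s k /run[D' [A' [-> inv' _ _]]] /= <-.
Qed.

End PriorityPropagation.

(** * The operator of a node constraint *)

Section SymbolConstraint.
Context {R : realType} {Sg : signature R} {V : Type}.
Variables (F : set R) (f : symbol Sg).
Variables (x : 'I_(arity f) -> icsp_var V) (y : icsp_var V).
Hypothesis x_inj : injective x.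
Hypothesis x_neq_y : forall j, x j <> y.
Let c := symbol_constraint x y.

Definition range_over (B : 'I_(arity f) -> set R) : set R :=
  [set v | exists2 a, (forall j, B j (a j)) & denote f a = Some v].

Lemma involves_symbol w : involves c w <-> w = y \/ exists j, w = x j.
Proof.
split=> [[k <-] /=|[->|[j ->]]].
- by case: unliftP => [j _|_]; [right; exists j|left].
- by exists ord_max; rewrite /= unlift_none.
- by exists (lift ord_max j); rewrite /= liftK.
Qed.

Lemma con_rel_symbol (s : icsp_var V -> R) :
  @con_rel _ _ c (s \o @con_var _ _ c) <-> denote f (s \o x) = Some (s y).
Proof.
rewrite /= /c /= unlift_none; suff -> : (fun j => s (if unlift ord_max
  (lift (@ord_max (arity f)) j) is Some i then x i else y)) = s \o x by [].
by apply/funext => j; rewrite liftK.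
Qed.

(** A consistent value is witnessed by a valuation of variables, so an arbitrary
tuple of arguments is only available when the variables are distinct. *)
Lemma exists_valuation (a : 'I_(arity f) -> R) (v : R) :
  exists s : icsp_var V -> R, s \o x = a /\ s y = v.
Proof.
exists (fun w => if [pick j | `[< x j = w >]] is Some j then a j else v).
split; last by case: pickP => [j /asboolP /x_neq_y|].
apply/funext => j /=; case: pickP => [i /asboolP /x_inj -> //|].
by move=> /(_ j); rewrite asboolT.
Qed.

Lemma consistent_output D :
  consistent c D y = range_over (D \o x).
Proof.
apply/seteqP; split=> v.
  move=> [s [<- /con_rel_symbol sr sD]]; exists (s \o x) => // j.
  by apply: sD => //; apply/involves_symbol; right; exists j.
move=> [a aD av]; have [s [sx sy]] := exists_valuation a v.
exists s; split => //; first by apply/con_rel_symbol; rewrite sx sy.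
move=> w /involves_symbol[-> //|[j ->] _].
by have := aD j; rewrite -sx.
Qed.

(** A value of one argument is completed by arbitrary values of the others;
the function is defined there, and its value is in the domain of [y]. *)
Lemma consistent_input D j :
  (forall i, D (x i) !=set0) ->
  (forall a, (forall i, D (x i) (a i)) -> denote f a <> None) ->
  range_over (D \o x) `<=` D y -> D (x j) `<=` consistent c D (x j).
Proof.
move=> D0 Df Dy v Dv; have [b bD] := choice D0.
pose a i := if i == j then v else b i.
have aD i : D (x i) (a i) by rewrite /a; case: eqP => [->|].
case fa : (denote f a) => [u|]; last by case: (Df a aD).
have [s [sx sy]] := exists_valuation a u.
have sxE i : s (x i) = a i by rewrite -sx.
exists s; split.
- by rewrite sxE /a eqxx.
- by apply/con_rel_symbol; rewrite sx sy.
- move=> w /involves_symbol[->|[i ->]] _; last by rewrite sxE.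
  by rewrite sy; apply: Dy; exists a.
Qed.

Variable g : dro_fun R (icsp_var V).
Hypothesis g_opt : optimal_dro F c g.

Lemma dro_symbol_output D : interval_domains F c D ->
  range_over (D \o x) `<=` D y -> g D y = interval_ext F (D \o x).
Proof.
move=> DF Dy; rewrite g_opt.2 //; last by apply/involves_symbol; left.
by congr hull; rewrite [X in _ `&` X]consistent_output setIidr.
Qed.

(** Every value of an argument is consistent, so the optimal operator leaves the
domains of the arguments as they are. *)
Lemma dro_symbol_other D : interval_domains F c D ->
  (forall i, D (x i) !=set0) ->
  (forall a, (forall i, D (x i) (a i)) -> denote f a <> None) ->
  range_over (D \o x) `<=` D y ->
  forall w, w <> y -> g D w = D w.
Proof.
move=> DF D0 Df Dy w wy; have [cw|cw] := pselect (involves c w); last first.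
  exact: (dro_other g_opt.1).
rewrite g_opt.2 //; case/involves_symbol: (cw) => [//|[j wj]].
rewrite setIidl ?hull_id //; first exact: DF.
by rewrite wj; exact: consistent_input.
Qed.

End SymbolConstraint.

Lemma consistent_ext (R : realType) (W : Type) (c : constraint R W) D D' w :
  (forall w', involves c w' -> D w' = D' w') ->
  consistent c D w = consistent c D' w.
Proof.
move=> DD'; apply/seteqP; split=> v [s [sv sc sD]]; exists s; split=> // w' cw';
  by move=> /(sD _ cw'); rewrite DD'.
Qed.

(** Default domains are a fixpoint by idempotence of the operator; optimality
transfers this to any [D] that agrees with them on the variables of [c],
whatever its values elsewhere. *)
Lemma dro_default (R : realType) (W : Type) (F : set R) (c : constraint R W) g D :
  optimal_dro F c g -> interval_domains F c D ->
  (forall w, involves c w -> D w = g (fun=> setT) w) ->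
  forall w, involves c w -> g D w = D w.
Proof.
move=> [gdro gopt] DF Ddef w cw.
have TF : interval_domains F c (fun=> setT) by move=> *; exact: fp_intervalT.
rewrite gopt // (consistent_ext _ Ddef) Ddef //.
by rewrite -[RHS](congr1 (@^~ w) (dro_idempotent gdro TF)) /=
  -gopt //; exact: dro_interval.
Qed.

(** * Positions in a term *)

Section Positions.
Context {R : realType} {Sg : signature R} {V : Type}.
Implicit Types (t u : term Sg V) (p q : seq nat).

Lemma subterm_nil t : subterm t [::] = Some t.
Proof. by case: t. Qed.

Lemma subterm_cat t p q u :
  subterm t p = Some u -> subterm t (p ++ q) = subterm u q.
Proof.
elim: p t => [|i p IH] t /=; first by rewrite subterm_nil => -[->].
by case: t => //= f args; case: insubP => // j _ _ /IH.
Qed.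

Lemma subterm_child t p f (args : 'I_(arity f) -> term Sg V)
    (j : 'I_(arity f)) :
  subterm t p = Some (App f args) -> subterm t (rcons p j) = Some (args j).
Proof.
by move=> /subterm_cat tp; rewrite -cats1 tp /= valK subterm_nil.
Qed.

Lemma occurs_subterm t p u x : subterm t p = Some u -> occurs u x -> occurs t x.
Proof.
by move=> /subterm_cat tp [q uq]; exists (p ++ q); rewrite /occurs_at tp.
Qed.

Lemma evaluable_subterm F X t p u :
  subterm t p = Some u -> evaluable F X t -> evaluable F X u.
Proof.
elim: p t => [|i p IH] t /=; first by rewrite subterm_nil => -[->].
by case: t => //= f args; case: insubP => // j _ _ /IH IHj [/(_ j)/IHj].
Qed.

Lemma label_inj t p q u u' : no_repeated_var t ->
  subterm t p = Some u -> subterm t q = Some u' -> label u p = label u' q ->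
  p = q.
Proof.
move=> nr; case: u u' => [x|f args] [x'|f' args'] // tp tq; last by case.
by case=> xx; apply: (nr x) => //; rewrite xx.
Qed.

Lemma node_constraintP t p c : node_constraint t p = Some c ->
  exists f (args : 'I_(arity f) -> term Sg V), subterm t p = Some (App f args) /\
    c = symbol_constraint (fun j => label (args j) (rcons p j)) (inr p).
Proof.
rewrite /node_constraint; case: (subterm t p) => [[//|f args]|//].
by case: ifP => // _ [<-]; exists f, args.
Qed.

Lemma node_constraint_App t p f (args : 'I_(arity f) -> term Sg V) :
  subterm t p = Some (App f args) -> arity f <> 0%N ->
  node_constraint t p =
    Some (symbol_constraint (fun j => label (args j) (rcons p j)) (inr p)).
Proof. by move=> tp /eqP/negbTE a0; rewrite /node_constraint tp a0. Qed.

(** The last argument of a constraint, recovered from the bare record; it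
identifies the node that generated the constraint. *)
Definition output (c : constraint R (icsp_var V)) : option (icsp_var V) :=
  let: Constraint n v _ := c in
  match n return ('I_n -> icsp_var V) -> option (icsp_var V) with
  | 0%N => fun=> None
  | m.+1 => fun v => Some (v ord_max)
  end v.

Lemma node_constraint_inj t p q c :
  node_constraint t p = Some c -> node_constraint t q = Some c -> p = q.
Proof.
have out r : node_constraint t r = Some c -> output c = Some (inr r).
  by move=> /node_constraintP[f [args [_ ->]]]; rewrite /= unlift_none.
by move=> /out cp /out; rewrite cp => -[].
Qed.

Lemma deeper_irr t c : ~ deeper t c c.
Proof.
by move=> [p [q [cp /(node_constraint_inj cp) <-]]]; rewrite ltnn.
Qed.

Lemma deeper_trans t c1 c2 c3 : deeper t c1 c2 -> deeper t c2 c3 -> deeper t c1 c3.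
Proof.
move=> [p1 [p2 [c1p c2p lt12]]] [p2' [p3 [c2p' c3p lt23]]].
exists p1, p3; split => //.
by rewrite (ltn_trans lt23) // -(node_constraint_inj c2p c2p').
Qed.

Lemma ieval_neq0 F X t : evaluable F X t ->
  (forall x, occurs t x -> X x !=set0) -> ieval F X t !=set0.
Proof.
elim: t => [x|f args IH] /=; first by move=> _; apply; exists [::].
move=> [eargs edef] X0.
have /choice[a aB] j : ieval F X (args j) !=set0.
  apply: IH => // x xj; apply: X0; apply: occurs_subterm xj.
  exact: (@subterm_child _ [::]).
case fa : (denote f a) => [v|]; last by case: (edef a aB).
by exists v; apply: sub_hull; exists a.
Qed.

End Positions.

(** * Propagation on the tree of a term *)

Section TermPropagation.
Context {R : realType} {Sg : signature R} {V : Type}.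
Variables (F : set R) (t : term Sg V) (X : V -> set R).
Variable dro : constraint R (icsp_var V) -> dro_fun R (icsp_var V).
Hypothesis finF : finite_set F.
Hypothesis X_itv : forall x, occurs t x -> fp_interval F (X x) /\ X x !=set0.
Hypothesis dro_opt :
  forall c, icsp_con (translate F X t) c -> optimal_dro F c (dro c).
Hypothesis t_linear : no_repeated_var t.
Hypothesis t_eval : evaluable F X t.
Implicit Types (u : term Sg V) (q : seq nat) (D : domains R (icsp_var V)).
Implicit Types (A : set (constraint R (icsp_var V))).
Let S := translate F X t.

(** One level of interval evaluation, reading the children in [D]. *)
Definition node_value D u q : set R :=
  match u with
  | Var x => X x
  | App f args => interval_ext F (fun j => D (label (args j) (rcons q j)))
  end.

(** Besides the local equation at inactive nodes, domains must remain above the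
intervals of evaluation: this keeps the image of the children inside the domain
of a node that is not yet evaluated, so that no child is reduced from above. *)
Record coherent D A : Prop := Coherent {
  coherent_active : A `<=` icsp_con S;
  coherent_interval : forall q u, subterm t q = Some u ->
    fp_interval F (D (label u q));
  coherent_ieval : forall q u, subterm t q = Some u ->
    ieval F X u `<=` D (label u q);
  coherent_settled : forall q u, subterm t q = Some u ->
    (forall c, node_constraint t q = Some c -> ~ A c) ->
    D (label u q) = node_value D u q }.

(** The local equations of a subtree without active constraints add up to the
recursion that defines [ieval]. *)
Lemma coherent_below D A u q : coherent D A -> subterm t q = Some u ->
  (forall q' c, node_constraint t (q ++ q') = Some c -> ~ A c) ->
  D (label u q) = ieval F X u.
Proof.
move=> coh; elim: u q => [x|f args IH] q tq inactive;
  rewrite (coherent_settled coh tq) //=;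
  try by move=> c cq; apply: (inactive [::]); rewrite cats0.
congr interval_ext; apply/funext => j; apply: IH; first exact: subterm_child.
by move=> q' c; rewrite cat_rcons => /inactive.
Qed.

Lemma fp_interval_ieval f (args : 'I_(arity f) -> term Sg V) :
  fp_interval F (ieval F X (App f args)).
Proof. exact: fp_interval_hull. Qed.

Section Node.
Variables (p : seq nat) (f : symbol Sg) (args : 'I_(arity f) -> term Sg V).
Hypothesis tp : subterm t p = Some (App f args).
Let x j : icsp_var V := label (args j) (rcons p j).

Lemma child_label_inj : injective x.
Proof.
move=> i j /(label_inj t_linear (subterm_child i tp) (subterm_child j tp)).
by move=> /eqP; rewrite eqseq_rcons => /andP[_ /eqP/val_inj].
Qed.

Lemma child_label_neq j : x j <> inr p.
Proof.
move=> /(label_inj t_linear (subterm_child j tp) tp) /(congr1 size).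
by rewrite size_rcons => /esym/n_Sn.
Qed.

Lemma node_interval_domains D :
  (forall q u, subterm t q = Some u -> fp_interval F (D (label u q))) ->
  interval_domains F (symbol_constraint x (inr p)) D.
Proof.
move=> DF w /involves_symbol[->|[j ->]]; first exact: DF tp.
exact: DF (subterm_child j tp).
Qed.

End Node.

(** Maximal depth makes the subtrees of the children inactive, hence the
children already carry their intervals of evaluation. *)
Lemma coherent_select D A (p : seq nat) f (args : 'I_(arity f) -> term Sg V) :
  let c := symbol_constraint (fun j => label (args j) (rcons p j)) (inr p) in
  coherent D A -> selectable (deeper t) A c ->
  subterm t p = Some (App f args) -> node_constraint t p = Some c ->
  [/\ forall j, D (label (args j) (rcons p j)) = ieval F X (args j),
      dro c D (inr p) = ieval F X (App f args) &
      forall w, w <> inr p -> dro c D w = D w].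
Proof.
move=> c coh [Ac maxc] tp cp.
have Dx j : D (label (args j) (rcons p j)) = ieval F X (args j).
  apply: (coherent_below coh); first exact: subterm_child.
  move=> q c' c'q Ac'; apply: (maxc c' Ac'); exists (rcons p j ++ q), p.
  by split => //; rewrite size_cat size_rcons leq_addr.
have DxE : D \o (fun j => label (args j) (rcons p j)) =
    fun j => ieval F X (args j) by apply/funext.
have [eargs edef] := evaluable_subterm tp t_eval.
have Dy : range_over (D \o (fun j => label (args j) (rcons p j)))
    `<=` D (inr p).
  rewrite DxE; exact: subset_trans (@sub_hull _ F _) (coherent_ieval coh tp).
have opt := dro_opt (coherent_active coh Ac).
have DF := node_interval_domains tp (coherent_interval coh).
have x_inj := child_label_inj tp; have x_neq := child_label_neq tp.
split => //; first by rewrite (dro_symbol_output x_inj x_neq opt DF Dy) DxE.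
apply: (dro_symbol_other x_inj x_neq opt DF) => //.
- move=> i; rewrite Dx; apply: ieval_neq0 => [|y yi]; first exact: eargs.
  by apply: (X_itv _).2; exact: occurs_subterm (subterm_child i tp) yi.
- by move=> a aD; apply: edef => j; rewrite -Dx.
Qed.

(** Only the variable of the selected node [p] may change, and it occurs in no
constraint other than those of [p] and of its parent. *)
Lemma coherent_step D A c : coherent D A -> selectable (deeper t) A c ->
  [/\ ~ emptied D (dro c D),
      coherent (dro c D) ((A `|` affected S D (dro c D)) `\ c) &
      forall c', affected S D (dro c D) c' -> c' <> c -> deeper t c c'].
Proof.
move=> coh sel; have [p cp] := coherent_active coh sel.1.
have [f [args [tp cE]]] := node_constraintP cp.
rewrite cE in sel cp *.
have [Dx Dp Dother] := coherent_select coh sel tp cp.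
move: (symbol_constraint _ _) sel cp Dp Dother => {cE}c sel cp Dp Dother.
have changed w : dro c D w <> D w -> w = inr p.
  by move=> Dw; apply: contrapT => /Dother.
have labelp q u : subterm t q = Some u -> label u q = inr p ->
    q = p /\ u = App f args.
  move=> tq lq; have qp := label_inj t_linear tq tp lq.
  by split => //; move: tq; rewrite qp tp => -[].
split.
- move=> [w Dw0 Dw].
  have wp : w = inr p by apply: changed; rewrite Dw => D0; case: Dw0; rewrite -D0.
  have [v Zv] : ieval F X (App f args) !=set0.
    apply: ieval_neq0; first exact: evaluable_subterm tp t_eval.
    by move=> y yi; apply: (X_itv _).2; exact: occurs_subterm tp yi.
  by move: Zv; rewrite -Dp -wp Dw.
- split.
  + by move=> c' [[Ac'|[//]] _]; exact: (coherent_active coh).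
  + move=> q u tq; have [lp|lp] := pselect (label u q = inr p).
      by rewrite lp Dp; exact: fp_interval_ieval.
    by rewrite Dother //; exact: (coherent_interval coh tq).
  + move=> q u tq; have [lp|lp] := pselect (label u q = inr p).
      by rewrite lp Dp (labelp _ _ tq lp).2.
    by rewrite Dother //; exact: (coherent_ieval coh tq).
  + move=> q u tq inactive; have [lp|lp] := pselect (label u q = inr p).
      have [_ uE] := labelp _ _ tq lp; rewrite lp Dp uE /=.
      have [qp _] := labelp _ _ tq lp; rewrite qp.
      congr interval_ext; apply/funext => j.
      by rewrite Dother ?Dx //; exact: child_label_neq.
    have nc c' : node_constraint t q = Some c' -> c' <> c.
      move=> c'q c'c; apply: lp; rewrite c'c in c'q.
      have qp := node_constraint_inj c'q cp.
      by move: tq; rewrite qp tp => -[<-].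
    rewrite Dother // (coherent_settled coh tq); last first.
      by move=> c' c'q Ac'; apply: (inactive c' c'q); split; [left|exact: nc].
    (* Had a child of [q] changed, the constraint of [q] would be active. *)
    case: u tq {lp} => [//|f' args'] tq; congr interval_ext.
    apply/funext => j; apply: contrapT => /nesym Dj.
    have a0 : arity f' <> 0%N by move=> f0; have := ltn_ord j; rewrite {2}f0.
    have c'q := node_constraint_App tq a0.
    apply: (inactive _ c'q); split; last exact: nc.
    right; split; first by exists q.
    exists (label (args' j) (rcons q j)) => //.
    by apply/involves_symbol; right; exists j.
- move=> c' [[q c'q] [w c'w /changed wp]] c'c.
  have [f' [args' [tq c'E]]] := node_constraintP c'q.
  exists p, q; split => //.
  move: c'w; rewrite c'E => /involves_symbol[|[j]]; rewrite wp.
    by move=> [pq]; case: c'c; move: c'q; rewrite -pq cp => -[].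
  move=> /esym/(labelp _ _ (subterm_child j tq))[<- _].
  by rewrite size_rcons.
Qed.

Lemma initial_const f (args : 'I_(arity f) -> term Sg V) :
  arity f = 0%N ->
  hull F [set v | exists a, denote f a = Some v] = ieval F X (App f args).
Proof.
move=> f0; congr hull; apply/seteqP; split=> v [a].
  by exists a => // j; have := ltn_ord j; rewrite {2}f0.
by exists a.
Qed.

(** A constraint that is not a seed already satisfies its local equation: its
operator fixes the default domains, among which that of the node is the whole
line, so the whole line is the interval image of the children. *)
Lemma coherent_init : coherent (icsp_dom S) (seed dro S).
Proof.
have itv q u : subterm t q = Some u -> fp_interval F (icsp_dom S (label u q)).
  case: u => [x|f args] tq /=; first by apply: (X_itv _).1; exists q.
  rewrite tq; case: eqP => _; first exact: fp_interval_hull.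
  exact: fp_intervalT.
split => //.
- by move=> c [].
- move=> q [x|f args] tq //; rewrite [label _ _]/= [icsp_dom _ _]/= tq.
  by case: eqP => // /(initial_const args) ->.
- move=> q [x|f args] tq inactive //=; rewrite tq.
  have [f0|/eqP f0] := eqVneq (arity f) 0%N.
    rewrite (initial_const args) //=; congr interval_ext.
    by apply/funext => j; have := ltn_ord j; rewrite {2}f0.
  have cq := node_constraint_App tq f0.
  set c := symbol_constraint _ _ in cq.
  have Sc : icsp_con S c by exists q.
  have opt := dro_opt Sc.
  have DF := node_interval_domains tq itv.
  have Dq : icsp_dom S (inr q) = setT by rewrite /= tq; case: eqP.
  have default w : involves c w -> icsp_dom S w = dro c (fun=> setT) w.
    move=> cw; apply: contrapT => Dw; apply: (inactive c cq).
    by split => //; exists w.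
  have cy : involves c (inr q) by apply/involves_symbol; left.
  transitivity (icsp_dom S (inr q)); first by rewrite Dq.
  rewrite -(dro_default opt DF default cy).
  rewrite (dro_symbol_output (child_label_inj tq) (child_label_neq tq) opt DF) //.
  by rewrite Dq.
Qed.

End TermPropagation.

Theorem theorem1 (R : realType) (F : set R) (Sg : signature R) (V : Type)
    (t : term Sg V) (X : V -> set R)
    (dro : constraint R (icsp_var V) -> dro_fun R (icsp_var V)) :
  finite_set F ->
  (forall x, occurs t x -> fp_interval F (X x) /\ X x !=set0) ->
  (forall c, icsp_con (translate F X t) c -> optimal_dro F c (dro c)) ->
  no_repeated_var t ->
  evaluable F X t ->
  [/\ psi_terminates dro (deeper t) (translate F X t)
        (psi_init dro (translate F X t)),
      forall s k,
        psi_run dro (deeper t) (translate F X t)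
          (psi_init dro (translate F X t)) s k ->
        uniq s &
      forall s k,
        psi_run dro (deeper t) (translate F X t)
          (psi_init dro (translate F X t)) s k ->
        final k -> config_dom k (root_var t) = ieval F X t].
Proof.
move=> finF X_itv dro_opt t_linear t_eval.
have [term once fin] := psi_invariant (@deeper_irr _ _ _ t) (@deeper_trans _ _ _ t)
  (fun D A => @coherent_active _ _ _ F t X D A)
  (coherent_step finF X_itv dro_opt t_linear t_eval)
  (coherent_init finF X_itv dro_opt t_linear).
split => // s k run /(fin _ _ run) coh.
by apply: (coherent_below coh (subterm_nil t)) => q' c _ [].
Qed.
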